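(* Let $\Gamma$ be a finite quiver, and let $\alpha,\beta:(T,f)\to(T',f')$ be morphisms in $\mathbf{Top}\text{-}\mathbf{Rep}\,\Gamma$ with $\alpha\simeq^t\beta$. Then the continuous maps $At^\Gamma(\alpha),At^\Gamma(\beta):At^\Gamma(T,f)\to At^\Gamma(T',f')$ are homotopic.
   Context: A quiver $\Gamma=(\Gamma_0,\Gamma_1)$ is an oriented graph; it is finite if $\Gamma_0$ and $\Gamma_1$ are finite. An object $(T,f)$ of $\mathbf{Top}\text{-}\mathbf{Rep}\,\Gamma$ (a top-representation) is a family of topological spaces $T(i)$, $i\in\Gamma_0$, with a continuous map $f_a:T(i)\to T(j)$ for each arrow $a:i\to j$; a morphism $\alpha:(T,f)\to(T',f')$ is a family of continuous maps $\alpha_i:T(i)\to T'(i)$ with $\alpha_jf_a=f'_a\alpha_i$ for each arrow $a:i\to j$. $\alpha\simeq^t\beta$ means that there are homotopies $H_i:T(i)\times I\to T'(i)$, $I=[0,1]$, from $\alpha_i$ to $\beta_i$ for each $i\in\Gamma_0$, such that $f'_aH_i=H_j(f_a\times1)$ for each arrow $a:i\to j$. $At^\Gamma(T,f)$ is the quotient space of $\coprod_{i\in\Gamma_0}T(i)$ by the equivalence relation generated by $D=\{(x_i,x_j): x_i\in T(i),\ x_j\in T(j),\ f_a(x_i)=x_j\text{ for some arrow }a:i\to j\}$; the class of $x$ is $\overline x$. For a morphism $\alpha$, $At^\Gamma(\alpha)$ is the induced continuous map $\overline{x}\mapsto\overline{\alpha_i(x)}$ for $x\in T(i)$. *)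

(* Defs.v *)
From HB Require Import structures.
From Stdlib Require Import Relation_Operators.
From mathcomp Require Import all_boot all_order all_algebra.
From mathcomp Require Import generic_quotient.
From mathcomp Require Import all_classical all_reals.
From mathcomp Require Import topology normedtype.

Set Implicit Arguments.
Unset Strict Implicit.
Unset Printing Implicit Defensive.

Import Order.TTheory GRing.Theory Num.Theory.
Import numFieldNormedType.Exports.

Local Open Scope classical_set_scope.
Local Open Scope ring_scope.
Local Open Scope quotient_scope.

(* The [choiceType] structures are required by the library's disjoint union
   topology on [{i & X i}]; classically every type carries one. *)
Record quiver := Quiver {
  vertex : choiceType;
  arrow : choiceType;
  source : arrow -> vertex;
  target : arrow -> vertex }.

Definition finite_quiver (G : quiver) : Prop :=
  finite_set [set: vertex G] /\ finite_set [set: arrow G].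

Record topRep (G : quiver) := TopRep {
  space :> vertex G -> topologicalType;
  rep_map : forall a : arrow G,
    continuousType (space (source a)) (space (target a)) }.

Record topRepHom (G : quiver) (T T' : topRep G) := TopRepHom {
  component :> forall i : vertex G, continuousType (T i) (T' i);
  component_natural : forall (a : arrow G) (x : T (source a)),
    component (target a) (rep_map T a x) =
    rep_map T' a (component (source a) x) }.

Definition unit_interval (R : realType) : set R := `[0, 1]%classic.
Arguments unit_interval R : clear implicits.

Lemma unit_interval0 (R : realType) : (0 : R) \in unit_interval R.
Proof. by apply/mem_set; rewrite /unit_interval /= in_itv /= lexx ler01. Qed.

Lemma unit_interval1 (R : realType) : (1 : R) \in unit_interval R.
Proof. by apply/mem_set; rewrite /unit_interval /= in_itv /= lexx ler01. Qed.

Definition I0 (R : realType) : unit_interval R := SigSub (unit_interval0 R).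
Definition I1 (R : realType) : unit_interval R := SigSub (unit_interval1 R).

(* [X * unit_interval R] carries the product topology, where
   [unit_interval R], as a type, has the topology induced from [R]. *)
Definition is_homotopy (R : realType) (X Y : topologicalType)
    (f g : continuousType X Y) (H : X * unit_interval R -> Y) : Prop :=
  [/\ continuous H,
      forall x, H (x, I0 R) = f x &
      forall x, H (x, I1 R) = g x].

Definition homotopic (R : realType) (X Y : topologicalType)
    (f g : continuousType X Y) : Prop :=
  exists H : X * unit_interval R -> Y, is_homotopy f g H.

Definition t_homotopic (R : realType) (G : quiver) (T T' : topRep G)
    (alpha beta : topRepHom T T') : Prop :=
  exists H : forall i : vertex G, T i * unit_interval R -> T' i,
    (forall i, is_homotopy (alpha i) (beta i) (H i)) /\
    (forall (a : arrow G) (x : T (source a)) (t : unit_interval R),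
       rep_map T' a (H (source a) (x, t)) = H (target a) (rep_map T a x, t)).

Section At.
Context (G : quiver) (T : topRep G).

Definition At_gen (x y : {i & T i}) : Prop :=
  exists (a : arrow G) (u : T (source a)),
    x = existT _ (source a) u /\ y = existT _ (target a) (rep_map T a u).

Definition At_rel (x y : {i & T i}) : bool :=
  `[< clos_refl_sym_trans {i & T i} At_gen x y >].

Lemma At_rel_refl : reflexive At_rel.
Proof. by move=> x; apply/asboolP; exact: rst_refl. Qed.

Lemma At_rel_sym : symmetric At_rel.
Proof. by move=> x y; apply/asboolP/asboolP; exact: rst_sym. Qed.

Lemma At_rel_trans : transitive At_rel.
Proof.
by move=> y x z /asboolP xy /asboolP yz; apply/asboolP; exact: rst_trans xy yz.
Qed.

Definition At_equiv := EquivRel At_rel At_rel_refl At_rel_sym At_rel_trans.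

Definition At := {eq_quot At_equiv}.

HB.instance Definition _ := Topological.copy At (quotient_topology At).
HB.instance Definition _ := Quotient.on At.

Definition At_class (i : vertex G) (x : T i) : At := \pi_At (existT _ i x).

End At.

Section At_map.
Context (G : quiver) (T T' : topRep G) (alpha : topRepHom T T').

Definition coprod_map : {i & T i} -> At T' :=
  fun p => At_class (alpha (projT1 p) (projT2 p)).

Definition At_map : At T -> At T' := coprod_map \o repr.

Lemma coprod_map_rel (x y : {i & T i}) :
  x = y %[mod At T] -> coprod_map x = coprod_map y.
Proof.
move=> /eqmodP /asboolP; elim=> {x y}.
- move=> _ _ [a [u [-> ->]]] /=; apply/eqmodP/asboolP/rst_step.
  by exists a, (alpha (source a) u); rewrite component_natural.
- by [].
- by move=> x y _ ->.
- by move=> x y z _ -> _ ->.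
Qed.

Lemma At_map_continuous : continuous At_map.
Proof.
have cts i : continuous (fun x : T i => At_class (alpha i x)).
  move=> x; apply: (continuous_comp (f := alpha i) (g := @At_class G T' i)).
    exact: cts_fun.
  apply: (continuous_comp (f := existT (fun j => T' j) i) (g := \pi_(At T'))).
    exact: existT_continuous.
  exact: pi_continuous.
apply: repr_comp_continuous; first exact: (sigT_continuous _ cts).
by move=> x y /eqP /coprod_map_rel ->.
Qed.

HB.instance Definition _ :=
  @isContinuous.Build (At T) (At T') At_map At_map_continuous.

Lemma At_map_class (i : vertex G) (x : T i) :
  At_map (At_class x) = At_class (alpha i x).
Proof.
by rewrite /At_map /= (@coprod_map_rel _ (existT _ i x)) // reprK.
Qed.

End At_map.

(* Main.v *)
Require Import Defs.
From HB Require Import structures.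
From mathcomp Require Import all_boot all_order all_algebra.
From mathcomp Require Import all_classical all_reals topology.
From mathcomp Require Import generic_quotient normedtype.

(** Over the unit interval I, each class of At T carries a path in At T': the
    slices H(-, t) of a t-homotopy are themselves morphisms of representations,
    so K(q, t) := At_map (slice t) q is well defined, and it clearly joins the
    two induced maps.  The point is that K is jointly continuous on At T * I,
    although a product of a quotient map with the identity of I has no reason
    to be a quotient map for a general space I.

    It is one here because I is compact and regular, so that maps X * I -> Y
    correspond to maps from X to the paths I -> Y in the compact-open topology.
    On the curried side the domain is At T alone, and the universal properties
    of the quotient and of the disjoint union apply to it directly
    ([At_prod_continuous]).  On each T i, the map K is H i followed by the class
    map of At T'. *)

Import numFieldNormedType.Exports.
Local Open Scope classical_set_scope.
Local Open Scope ring_scope.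
Local Open Scope quotient_scope.

(** A proper filter on the subtype A pushes forward to a proper filter on X that
    contains A; its cluster point in A is a cluster point of the original
    filter because the neighbourhoods in A are traces of those in X. *)
Lemma compact_set_type (X : topologicalType) (A : set X) :
  compact A -> compact [set: A].
Proof.
move=> cA F FF _.
have FA : (set_val @ F) A.
  by apply: (filterS (F := F)) filterT => -[x xA] _; exact: set_mem xA.
have [p [Ap clp]] := cA _ (fmap_proper_filter (@set_val _ A) FF) FA.
exists (SigSub (mem_set Ap)); split=> // B C FB.
rewrite nbhsE => -[_ [[W oW <-] Wp] WC].
have FB' : (set_val @ F) (set_val @` B).
  by apply: (filterS (F := F)) FB => x Bx; exists x.
have [_ [[b Bb <-] Wb]] := clp _ _ FB' (open_nbhs_nbhs (conj oW Wp)).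
by exists b; split=> //; exact: WC.
Qed.

Lemma unit_interval_locally_compact (R : realType) :
  locally_compact [set: unit_interval R].
Proof.
move=> x _; rewrite withinET; exists setT; first exact: filterT.
by split; [apply/compact_set_type/segment_compact | exact: closedT].
Qed.

Lemma At_class_continuous (G : quiver) (T : topRep G) (i : vertex G) :
  continuous (@At_class G T i).
Proof.
move=> x; apply: (continuous_comp (f := existT (fun j => T j) i)).
  exact: existT_continuous.
exact: pi_continuous.
Qed.

Lemma At_class_surj (G : quiver) (T : topRep G) (q : At T) :
  exists (i : vertex G) (x : T i), q = At_class x.
Proof.
exists (projT1 (repr q)), (projT2 (repr q)).
by rewrite /At_class -sigT_eta reprK.
Qed.

Section exponential.
Import ArrowAsCompactOpen.

(** The universal property of At T persists after taking the product with a
    locally compact regular space V: currying turns K into a map from At T to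
    the space of functions V -> W with the compact-open topology, whose
    continuity can be tested on each T i, and local compactness is what allows
    uncurrying again. *)
Lemma At_prod_continuous (G : quiver) (T : topRep G) (V W : topologicalType)
    (K : At T * V -> W) :
  locally_compact [set: V] -> @regular_space V ->
  (forall i, continuous (fun p : T i * V => K (At_class p.1, p.2))) ->
  continuous K.
Proof.
move=> lcV regV cK.
have -> : K = uncurry (curry K) by apply/funext => -[].
apply: continuous_uncurry_regular => //; last first.
  move=> q; have [i [x ->]] := At_class_surj _ _ q.
  by have [_] := continuous_curry (cK i); exact.
apply/quotient_continuous.
have -> : curry K \o \pi_(At T) = fun s : {i & T i} =>
    curry (fun p : T (projT1 s) * V => K (At_class p.1, p.2)) (projT2 s).
  by apply/funext => -[].
exact: (sigT_continuous _ (fun i => continuous_curry_fun (cK i))).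
Qed.

End exponential.

Section slice.
Context {R : realType} {G : quiver} {T T' : topRep G}.
Context (H : forall i : vertex G, T i * unit_interval R -> T' i)
  (H_continuous : forall i, continuous (H i))
  (H_natural :
    forall (a : arrow G) (x : T (source a)) (t : unit_interval R),
      rep_map T' a (H (source a) (x, t)) = H (target a) (rep_map T a x, t)).

Lemma slice_continuous (t : unit_interval R) (i : vertex G) :
  continuous (fun x => H i (x, t)).
Proof.
move=> x; apply: (continuous_comp (f := fun y => (y, t)) (g := H i)).
  exact: (cvg_pair (F := nbhs x) (@cvg_id _ (nbhs x)) (cvg_cst t)).
exact: H_continuous.
Qed.

Definition slice_component t i : continuousType (T i) (T' i) :=
  HB.pack (fun x => H i (x, t)) (isContinuous.Build _ _ _ (slice_continuous t i)).

Lemma slice_natural t (a : arrow G) (x : T (source a)) :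
  slice_component t (target a) (rep_map T a x) =
  rep_map T' a (slice_component t (source a) x).
Proof. by rewrite /= H_natural. Qed.

(** Since each slice is a morphism, [At_map] applies to it, and no separate
    argument is needed for the induced homotopy to respect the classes. *)
Definition slice t : topRepHom T T' := TopRepHom (slice_natural t).

End slice.

Theorem theorem6p4 (R : realType) (G : quiver) (T T' : topRep G)
    (alpha beta : topRepHom T T') :
  finite_quiver G ->
  t_homotopic R alpha beta ->
  homotopic R (At_map alpha) (At_map beta).
Proof.
move=> _ [H [Hhom Hnat]].
have Hc i : continuous (H i) by have [] := Hhom i.
exists (fun p => At_map (slice H Hc Hnat p.2) p.1); split.
- apply: At_prod_continuous.
  + exact: unit_interval_locally_compact.
  + exact: uniform_regular.
  + move=> i.
    have -> : (fun p : T i * unit_interval R =>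
        At_map (slice H Hc Hnat p.2) (At_class p.1)) = @At_class G T' i \o H i.
      by apply/funext => -[x t] /=; rewrite At_map_class.
    move=> p; apply: continuous_comp; first exact: Hc.
    exact: At_class_continuous.
- move=> q; have [i [x ->]] := At_class_surj _ _ q.
  by have [_ H0 _] := Hhom i; rewrite /= !At_map_class /= H0.
- move=> q; have [i [x ->]] := At_class_surj _ _ q.
  by have [_ _ H1] := Hhom i; rewrite /= !At_map_class /= H1.
Qed.
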